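(* Let $X=\{x,y\}$ and let $\sigma\subseteq\overline{\Omega}_X\mathsf S$ be a nonempty set of binary implicit operations such that every $w\in\sigma$ satisfies one of the following properties: (1) either $x^3$ or $y^3$ is a suffix of $w$; (2) both $xyx$ and $yxy$ are subwords of $w$. Suppose further that the pseudovariety of groups $\mathsf H_\sigma=[\![w=1: w\in\sigma]\!]$ has infinite exponent. Let $\mathsf{Ab}$ be the pseudovariety of all finite Abelian groups. Then no pseudovariety $\mathsf V$ with $\mathsf H_\sigma\cap\mathsf{Ab}\subseteq\mathsf V\subseteq\mathsf H_\sigma$ is $\sigma\cup\{\omega\}$-reducible (for the equation $x=y$), where $\sigma\cup\{\omega\}$ denotes the implicit signature consisting of binary multiplication, the operations in $\sigma$, and the unary $\omega$-power.
   Context: A pseudovariety of semigroups is a class of finite semigroups closed under taking subsemigroups, homomorphic images and finite direct products. For a finite set $A$, $\overline{\Omega}_A\mathsf S$ denotes the free profinite semigroup on $A$; its elements are called pseudowords, and the free semigroup $A^+$ is a dense subsemigroup. Each $w\in\overline{\Omega}_A\mathsf S$ is interpreted in a profinite semigroup $S$ as the $A$-ary operation $w_S:S^A\to S$, $w_S(\varphi)=\hat\varphi(w)$, where $\hat\varphi:\overline{\Omega}_A\mathsf S\to S$ is the unique continuous homomorphism extending $\varphi:A\to S$; elements of $\overline{\Omega}_A\mathsf S$ are therefore also called $A$-ary implicit operations (binary if $A=\{x,y\}$). For $k\in\mathbb Z$, $x^{\omega+k}=\lim_{n\to\infty}x^{n!+k}$. For $u,v\in\overline{\Omega}_A\mathsf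 S$, a finite semigroup $S$ satisfies $u=v$ if $u_S=v_S$; $\mathsf V\models u=v$ means every $S\in\mathsf V$ satisfies $u=v$; $[\![\Sigma]\!]$ is the class of all finite semigroups satisfying all pseudoidentities in $\Sigma$. The abbreviation $w=1$ stands for the pair of pseudoidentities $wz=z=zw$, where $z$ is a variable not occurring in $w$ (so $S$ satisfies $w=1$ iff $S$ has an identity element and $w_S$ is constantly equal to it). A pseudovariety has infinite exponent if it satisfies no pseudoidentity of the form $x^{\omega+n}=x^\omega$ with $n$ a positive integer. A word $v$ is a suffix of a pseudoword $w$ if $w=w'v$ for some, possibly empty, pseudoword $w'$. A word $a_1a_2\cdots a_n$ (with $a_i$ letters) is a subword of $w$ if there are possibly empty pseudowords $w_0,\dots,w_n$ with $w=w_0a_1w_1a_2\cdots a_nw_n$ (scattered subword). An implicit signature $\tau$ is a set of pseudowords (over finite alphabets) that includes binary multiplication. For a finite set $A$, $\Omega^\tau_A\mathsf S$ is the smallest subset of $\overline{\Omega}_A\mathsf S$ containing $A$ and closed under all operations in $\tau$; its elements are called $\tau$-words. Given a pseudovariety $\mathsf V$, a finite semigroup $S$, elements $s,t\in S$, and an onto continuous homomorphism $\varphi:\overline{\Omega}_A\mathsf S\to S$ with $A$ finite, a $\mathsf V$-solution of the equation $x=y$ for the triple $(S,s,t)$ is a pair $u,v\in\overline{\Omega}_A\mathsf S$ such that $\mathsf V\models u=v$, $\varphi(u)=s$ and $\varphi(v)=t$. The pseudovariety $\mathsf V$ is $\tau$-reducible (for the equation $x=y$) if, whenever there is a $\mathsf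 V$-solution for a triple $(S,s,t)$, there is a $\mathsf V$-solution $(u,v)$ for it with both $u$ and $v$ $\tau$-words (over the same $A$, with respect to the same $\varphi$). This property is independent of the choice of the onto continuous homomorphism $\varphi$. *)

(* Defs.v *)
From HB Require Import structures.
From mathcomp Require Import all_boot monoid.
From mathcomp Require Import boolp classical_sets functions filter.
From mathcomp Require Import topology function_spaces separation_axioms.

Set Implicit Arguments.
Unset Strict Implicit.
Unset Printing Implicit Defensive.

Import Algebra.

Local Open Scope classical_set_scope.
Local Open Scope group_scope.

(* Semigroups are nonempty, as is needed for [w = 1] to assert the existence of
   an identity element. *)
HB.mixin Record isNonempty T := { nonempty : inhabited T }.

#[short(type="finSemigroupType")]
HB.structure Definition FinSemigroup :=
  {S of Semigroup S & Finite S & isNonempty S}.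

Lemma prod_nonempty (S T : finSemigroupType) : inhabited (S * T)%type.
Proof. by have [[s] [t]] := (nonempty (s := S), nonempty (s := T)). Qed.

HB.instance Definition _ (S T : finSemigroupType) :=
  isNonempty.Build (S * T)%type (prod_nonempty S T).

Lemma fstM (S T : finSemigroupType) : {morph @fst S T : p q / p * q}.
Proof. by []. Qed.

Lemma sndM (S T : finSemigroupType) : {morph @snd S T : p q / p * q}.
Proof. by []. Qed.

HB.instance Definition _ (S T : finSemigroupType) :=
  isMultiplicative.Build (S * T)%type S fst (@fstM S T).
HB.instance Definition _ (S T : finSemigroupType) :=
  isMultiplicative.Build (S * T)%type T snd (@sndM S T).

Definition onto (S T : Type) (h : S -> T) := forall t, exists s, h s = t.

Definition semigroupClass := finSemigroupType -> Prop.

(* The one-element semigroups are the empty direct products. *)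
Definition pseudovariety (V : semigroupClass) :=
  [/\ forall (S T : finSemigroupType) (h : {multiplicative T -> S}),
        injective h -> V S -> V T,
      forall (S T : finSemigroupType) (h : {multiplicative S -> T}),
        onto h -> V S -> V T,
      forall S T : finSemigroupType, V S -> V T -> V (S * T)%type
    & forall S : finSemigroupType, #|S| = 1%N -> V S].

(* Semigroup structures on initial segments of nat: up to isomorphism, all
   finite semigroups, but indexed by a small type. The empty semigroup is
   included: it makes the absence of operations of arity 0 immediate. *)
Record table := Table {
  tsize : nat;
  tmul : 'I_tsize -> 'I_tsize -> 'I_tsize;
  tmulA : associative tmul }.

(* The free profinite semigroup on [A], realized as the semigroup of A-ary
   implicit operations: families of operations [S^A -> S], one for each finite
   semigroup S, commuting with all homomorphisms. *)
Record pseudoword (A : finType) := Pseudoword {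
  pwop :> forall S : table, (A -> 'I_(tsize S)) -> 'I_(tsize S);
  pwopP : forall (S T : table) (h : 'I_(tsize S) -> 'I_(tsize T)),
    {morph h : i j / tmul i j} ->
    forall f : A -> 'I_(tsize S), h (pwop f) = pwop (h \o f) }.

Lemma pseudowordP (A : finType) (u v : pseudoword A) :
  (forall (S : table) (f : A -> 'I_(tsize S)), u S f = v S f) -> u = v.
Proof.
case: u v => [u uP] [v vP] /= uv.
have {}uv : u = v by apply: functional_extensionality_dep => S; apply: funext.
by case: _ / uv vP => vP; congr Pseudoword; apply: Prop_irrelevance.
Qed.

HB.instance Definition _ (A : finType) := gen_eqMixin (pseudoword A).
HB.instance Definition _ (A : finType) := gen_choiceMixin (pseudoword A).

Section PseudowordSemigroup.
Variable A : finType.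

Definition letter (a : A) : pseudoword A :=
  @Pseudoword A (fun S f => f a) (fun S T h hM f => erefl).

Definition pwmul (u v : pseudoword A) : pseudoword A.
Proof.
exists (fun S f => tmul (u S f) (v S f)) => S T h hM f.
by rewrite hM !(pwopP _ hM).
Defined.

Lemma pwmulA : associative pwmul.
Proof. by move=> u v w; apply: pseudowordP => S f /=; rewrite tmulA. Qed.

HB.instance Definition _ := isSemigroup.Build (pseudoword A) pwmulA.

End PseudowordSemigroup.

(* The topology of pointwise convergence, the finite semigroups being
   discrete. *)
Section PseudowordTopology.
Variable A : finType.

Definition pwindex := {S : table & A -> 'I_(tsize S)}.

Definition pwcoord (w : pseudoword A) :
  prod_topology (fun i : pwindex => discrete_topology 'I_(tsize (tag i))) :=
  fun i => w (tag i) (tagged i).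

HB.instance Definition _ :=
  Topological.copy (pseudoword A) (initial_topology pwcoord).

End PseudowordTopology.

HB.instance Definition _ := isPointed.Build (pseudoword unit) (letter tt).

Section Evaluation.
Variables (A : finType) (S : finSemigroupType).

Definition table_mul (i j : 'I_#|S|) : 'I_#|S| :=
  enum_rank (enum_val i * enum_val j : S).

Lemma table_mulA : associative table_mul.
Proof. by move=> i j k; rewrite /table_mul !enum_rankK mulgA. Qed.

Definition table_of : table := Table table_mulA.

(* The value [w_S(f)] in a finite semigroup S. *)
Definition eval (f : A -> S) (w : pseudoword A) : S :=
  enum_val (w table_of (enum_rank \o f)).

Lemma eval_letter f a : eval f (letter a) = f a.
Proof. exact: enum_rankK. Qed.

Lemma evalM f : {morph eval f : u v / u * v}.
Proof. by move=> u v; rewrite /eval /= /table_mul enum_rankK. Qed.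

HB.instance Definition _ f :=
  isMultiplicative.Build (pseudoword A) S (eval f) (evalM f).

End Evaluation.

Lemma eval_natural (A : finType) (S T : finSemigroupType)
    (h : {multiplicative S -> T}) (f : A -> S) (w : pseudoword A) :
  h (eval f w) = eval (h \o f) w.
Proof.
pose h' (i : 'I_(tsize (table_of S))) : 'I_(tsize (table_of T)) :=
  enum_rank (h (enum_val i)).
have h'M : {morph h' : i j / tmul i j}.
  by move=> i j; rewrite /h' /= /table_mul !enum_rankK gmulfM.
rewrite /eval -[LHS]enum_rankK; congr enum_val.
rewrite -/(h' _) (pwopP _ h'M).
suff -> : h' \o (enum_rank \o f) = enum_rank \o (h \o f) by [].
by apply: funext => a; rewrite /h' /= enum_rankK.
Qed.

(* The value [w_T(u)] in the profinite semigroup T of pseudowords over B. *)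
Definition subst (A B : finType) (u : A -> pseudoword B) (w : pseudoword A) :
  pseudoword B.
Proof.
exists (fun S f => w S (fun a => u a S f)) => S T h hM f.
rewrite (pwopP w hM).
suff -> : h \o (fun a => u a S f) = fun a => u a T (h \o f) by [].
by apply: funext => a /=; rewrite (pwopP _ hM).
Defined.

Lemma subst_letter (A B : finType) (u : A -> pseudoword B) a :
  subst u (letter a) = u a.
Proof. exact: pseudowordP. Qed.

Lemma substM (A B : finType) (u : A -> pseudoword B) :
  {morph subst u : v w / v * w}.
Proof. by move=> v w; apply: pseudowordP. Qed.

HB.instance Definition _ (A B : finType) (u : A -> pseudoword B) :=
  isMultiplicative.Build (pseudoword A) (pseudoword B) (subst u) (substM u).

Lemma eval_subst (A B : finType) (S : finSemigroupType)
    (u : A -> pseudoword B) (f : B -> S) (w : pseudoword A) :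
  eval f (subst u w) = eval (fun a => eval f (u a)) w.
Proof.
rewrite /eval /=.
suff -> : (fun a => u a (table_of S) (enum_rank \o f)) =
  enum_rank \o (fun a => eval f (u a)) by [].
by apply: funext => a /=; rewrite enum_valK.
Qed.

Section Carrier.
Variables (S : table) (S_gt0 : (0 < tsize S)%N).

Definition carrier of (0 < tsize S)%N : Type := 'I_(tsize S).

HB.instance Definition _ := Finite.copy (carrier S_gt0) 'I_(tsize S).
HB.instance Definition _ := isSemigroup.Build (carrier S_gt0) (@tmulA S).
HB.instance Definition _ :=
  isNonempty.Build (carrier S_gt0) (inhabits (Ordinal S_gt0)).

Lemma eval_carrier (A : finType) (w : pseudoword A) (f : A -> carrier S_gt0) :
  eval f w = w S f.
Proof.
pose h (i : 'I_(tsize S)) : 'I_(tsize (table_of (carrier S_gt0))) :=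
  enum_rank (i : carrier S_gt0).
have hM : {morph h : i j / tmul i j}.
  by move=> i j; rewrite /h /= /table_mul !enum_rankK.
by rewrite /eval -[RHS]enum_rankK -/(h _) (pwopP _ hM).
Qed.

End Carrier.

Lemma tsize_gt0 (A : finType) (w : pseudoword A) (S : table)
  (f : A -> 'I_(tsize S)) : (0 < tsize S)%N.
Proof. exact: leq_trans (ltn_ord (w S f)). Qed.

(* The subsemigroup A^+ of finite words. *)
Inductive finite_word (A : finType) : set (pseudoword A) :=
  | finite_word_letter a : finite_word (letter a)
  | finite_wordM u v : finite_word u -> finite_word v -> finite_word (u * v).

Section UniversalProperty.
Variable A : finType.
Implicit Types (u v w : pseudoword A) (S : finSemigroupType).

Lemma eval_inj u v : (forall S (f : A -> S), eval f u = eval f v) -> u = v.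
Proof.
move=> uv; apply: pseudowordP => S f.
have S_gt0 := tsize_gt0 u f.
by have := uv (carrier S_gt0) f; rewrite !eval_carrier.
Qed.

Lemma eval_finite_word S (f : A -> S) w :
  exists2 u, finite_word u & eval f u = eval f w.
Proof.
pose G := [set p : S | `[< exists2 u, finite_word u & eval f u = p >]]%SET.
have GP p : reflect (exists2 u, finite_word u & eval f u = p) (p \in G).
  by rewrite finset.in_set; exact: asboolP.
have fG a : f a \in G.
  by apply/GP; exists (letter a); [left | exact: eval_letter].
have GM p q : p \in G -> q \in G -> p * q \in G.
  move=> /GP[u uW <-] /GP[v vW <-]; apply/GP.
  by exists (u * v); [right | rewrite gmulfM].
pose m (i j : 'I_#|G|) : 'I_#|G| :=
  enum_rank_in (enum_valP i) (enum_val i * enum_val j).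
have mE i j : enum_val (m i j) = enum_val i * enum_val j.
  by rewrite enum_rankK_in // GM ?enum_valP.
have mA : associative m.
  by move=> i j k; apply: enum_val_inj; rewrite !mE mulgA.
pose h (i : 'I_(tsize (Table mA))) : 'I_(tsize (table_of S)) :=
  enum_rank (enum_val i).
have hM : {morph h : i j / tmul i j}.
  by move=> i j; rewrite /h /= /table_mul !enum_rankK mE.
pose g a : 'I_(tsize (Table mA)) := enum_rank_in (fG a) (f a).
have hg : h \o g = enum_rank \o f.
  by apply: funext => a; rewrite /h /g /= enum_rankK_in.
have : eval f w \in G.
  by rewrite /eval -hg -(pwopP _ hM) /h enum_rankK enum_valP.
by move/GP.
Qed.

Lemma nbhs_pseudoword w (U : set (pseudoword A)) :
  nbhs w U <->
  exists (S : finSemigroupType) (f : A -> S),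
    forall u, eval f u = eval f w -> U u.
Proof.
split; last first.
  move=> [S [f fU]].
  pose i : pwindex A := existT _ (table_of S) (enum_rank \o f).
  have /cvg_sup/(_ i) wi : @pwcoord A @ w --> pwcoord w.
    exact: (@initial_continuous _ _ (@pwcoord A) w).
  have : (@pwcoord A @ w) [set g | g i = pwcoord w i].
    apply: wi; first exact/fmap_filter/nbhs_filter.
    exists [set g | g i = pwcoord w i] => //; split=> //.
    by exists [set pwcoord w i] => //; exact: discrete_open.
  move=> wi'; apply: (@filterS _ (nbhs w) _ _ _ _ wi') => u /= ui.
  by apply: fU; rewrite /eval; congr enum_val.
move=> wU; pose F : set_system (pseudoword A) := fun U =>
  exists (S : finSemigroupType) (f : A -> S),
    forall u, eval f u = eval f w -> U u.
have FF : Filter F.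
  split.
  - pose T := @Table 1 (fun i _ => i) (fun _ _ _ => erefl).
    by exists (carrier (ltn0Sn 0 : 0 < tsize T)%N), (fun=> ord0).
  - move=> P Q [S [f fP]] [T [g gQ]].
    exists (S * T)%type, (fun a => (f a, g a)) => u fgu; split.
      apply: fP; move: (congr1 fst fgu).
      by rewrite !(eval_natural fst).
    apply: gQ; move: (congr1 snd fgu).
    by rewrite !(eval_natural snd).
  - by move=> P Q PQ [S [f fP]]; exists S, f => u /fP/PQ.
have : @pwcoord A @ F --> pwcoord w.
  apply/cvg_sup => -[S f] V [B [[C oC <-] Cw] BV].
  have S_gt0 := tsize_gt0 w f.
  exists (carrier S_gt0), f => u; rewrite !eval_carrier => uw.
  by apply: BV; rewrite /= /pwcoord /= uw.
case: wU => B [[C oC <-] Cw] CU Fw.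
have : F (@pwcoord A @^-1` C) by apply: Fw; exact: open_nbhs_nbhs.
by move=> [S [f fC]]; exists S, f => u /fC /CU.
Qed.

Lemma dense_finite_word : dense (@finite_word A).
Proof.
move=> O [w Ow] oO.
have /nbhs_pseudoword[S [f fO]] : nbhs w O by exact: open_nbhs_nbhs.
by have [u uW ufw] := eval_finite_word f w; exists u; split=> //; apply: fO.
Qed.

Lemma eval_continuous S (f : A -> S) :
  continuous (eval f : pseudoword A -> discrete_topology S).
Proof.
move=> w U fU; apply/nbhs_pseudoword; exists S, f => u /= ->.
exact: nbhs_singleton fU.
Qed.

Lemma eval_unique S (h : {multiplicative pseudoword A -> S}) :
  continuous (h : pseudoword A -> discrete_topology S) ->
  h =1 eval (h \o @letter A).
Proof.
move=> hc w; set g := h \o _.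
have gE u : finite_word u -> h u = eval g u.
  by elim=> [a|{}u v _ uE _ vE]; rewrite ?eval_letter // !gmulfM uE vE.
have : nbhs w (h @^-1` [set h w]).
  by apply: hc; exact: (discrete_set1 (h w : discrete_topology S)).
move=> /nbhs_pseudoword[T [f fh]].
have [u uW ufg] := eval_finite_word (fun a => (f a, g a)) w.
rewrite -(fh u) => [|{fh}]; last first.
  by move: (congr1 fst ufg); rewrite !(eval_natural fst).
by rewrite gE //; move: (congr1 snd ufg); rewrite !(eval_natural snd).
Qed.

Lemma pseudoword_hausdorff : hausdorff_space (pseudoword A).
Proof.
move=> u v uv; apply: eval_inj => S f.
have nE w : nbhs w (eval f @^-1` [set eval f w]).
  by apply/nbhs_pseudoword; exists S, f.
by have [w [<- <-]] := uv _ _ (nE u) (nE v).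
Qed.

End UniversalProperty.

Lemma subst_continuous (A B : finType) (u : A -> pseudoword B) :
  continuous (subst u).
Proof.
move=> w U /nbhs_pseudoword[S [f fU]]; apply/nbhs_pseudoword.
exists S, (fun a => eval f (u a)) => v; rewrite -!eval_subst; exact: fU.
Qed.

Lemma subst_unique (A B : finType)
    (h : {multiplicative pseudoword A -> pseudoword B}) :
  continuous h -> h =1 subst (h \o @letter A).
Proof.
move=> hc w; apply: eval_inj => S f; rewrite eval_subst.
apply: (@eval_unique A S (eval f \o h)) => v.
by apply: continuous_comp; [exact: hc | exact: eval_continuous].
Qed.

(* The power [u ^ n], meaningful for n > 0 only. *)
Definition spow (S : semigroupType) (u : S) (n : nat) : S := iterop n *%g u u.

Lemma spowS (S : semigroupType) (u : S) n :
  (0 < n)%N -> spow u n.+1 = u * spow u n.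
Proof. by case: n. Qed.

Lemma spowD (S : semigroupType) (u : S) m n :
  (0 < m)%N -> (0 < n)%N -> spow u (m + n) = spow u m * spow u n.
Proof.
move=> + n_gt0; elim: m => [//|[|m] IHm] _; first exact: spowS.
by rewrite addSn spowS ?addn_gt0 // IHm // mulgA -spowS.
Qed.

Lemma gmulf_spow (S T : semigroupType) (h : {multiplicative S -> T}) u n :
  h (spow u n) = spow (h u) n.
Proof.
elim: n => [//|[//|n] IHn].
by rewrite (spowS u (ltn0Sn n)) (spowS (h u) (ltn0Sn n)) gmulfM IHn.
Qed.

Lemma eval_spow (A : finType) (S : finSemigroupType) (f : A -> S) a n :
  eval f (spow (letter a) n) = spow (f a) n.
Proof. by rewrite gmulf_spow; congr spow; exact: eval_letter. Qed.

Lemma spow_fact (S : finSemigroupType) (s : S) (k n : nat) :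
  (#|S| <= n)%N -> spow s (n`! + k) = spow s ((#|S|)`! + k).
Proof.
have S_gt0 : (0 < #|S|)%N by rewrite (cardD1 s).
have [i [p [i_gt0 iS p_gt0 pS per]]] : exists i p : nat,
    [/\ (0 < i)%N, (i <= #|S|)%N, (0 < p)%N, (p <= #|S|)%N
      & spow s (i + p) = spow s i].
  pose F (i : 'I_#|S|.+1) := spow s i.+1.
  have /injectivePn[a [b ab Fab]] : ~~ injectiveb F.
    apply/negP => /injectiveP/leq_card; rewrite card_ord.
    by rewrite ltnn.
  wlog ltab : a b ab Fab / (a < b)%N => [H|].
    case: (ltngtP a b) => [lt|lt|/val_inj eq].
    - exact: (H a b).
    - by apply: (H b a); rewrite // eq_sym.
    - by rewrite eq eqxx in ab.
  exists a.+1, (b - a)%N; split=> //.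
  - by rewrite (leq_trans ltab) // -ltnS.
  - by rewrite subn_gt0.
  - by rewrite (leq_trans (leq_subr _ _)) // -ltnS.
  - by rewrite addSn subnKC ?(ltnW ltab).
have per1 m : (i <= m)%N -> spow s (m + p) = spow s m.
  move=> im; case: (posnP (m - i)) => [/eqP|mi].
    by rewrite subn_eq0 => mi; rewrite (@anti_leq m i) ?mi ?im.
  by rewrite -(subnK im) -addnA spowD ?addn_gt0 ?i_gt0 // per -spowD.
have perq m q : (i <= m)%N -> spow s (m + q * p) = spow s m.
  move=> im; elim: q => [|q IHq]; first by rewrite mul0n addn0.
  by rewrite mulSn addnCA addnC per1 ?IHq // (leq_trans im) // leq_addr.
move=> Sn.
have leF : ((#|S|)`! <= n`!)%N by rewrite leq_fact.
have dvp m : (#|S| <= m)%N -> (p %| m`!)%N.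
  by move=> Sm; rewrite dvdn_fact // p_gt0 (leq_trans pS).
have /dvdnP[q nq] : (p %| n`! - (#|S|)`!)%N by rewrite dvdn_sub // dvp.
rewrite -(subnK leF) nq -addnA addnC.
by rewrite perq // (leq_trans iS) // (leq_trans (fact_geq _)) // leq_addr.
Qed.

(* The unary operation x^(omega + k). *)
Definition omega (k : nat) : pseudoword unit :=
  lim ((spow (letter tt) (n`! + k)%N : pseudoword unit) @[n --> \oo]).

Lemma omegaP k :
  (spow (letter tt) (n`! + k)%N : pseudoword unit) @[n --> \oo] --> omega k /\
  forall (S : finSemigroupType) (f : unit -> S),
    eval f (omega k) = spow (f tt) ((#|S|)`! + k).
Proof.
pose X n : pseudoword unit := spow (letter tt) (n`! + k).
have XS (S : table) (f : unit -> 'I_(tsize S)) n :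
    (tsize S <= n)%N -> X n S f = X (tsize S) S f.
  move=> Sn; have S_gt0 := tsize_gt0 (letter tt) f.
  have E m : X m S f = spow (f tt : carrier S_gt0) (m`! + k).
    by rewrite -(@eval_carrier S S_gt0) eval_spow.
  rewrite !E; have := @spow_fact (carrier S_gt0) (f tt) k n.
  by rewrite (card_ord (tsize S) : #|{: carrier S_gt0}| = _); apply.
have LP (S T : table) (h : 'I_(tsize S) -> 'I_(tsize T)) :
    {morph h : i j / tmul i j} -> forall f : unit -> 'I_(tsize S),
    h (X (tsize S) S f) = X (tsize T) T (h \o f).
  move=> hM f; rewrite -(XS S f (maxn (tsize S) (tsize T))) ?leq_maxl //.
  by rewrite (pwopP _ hM) XS // leq_maxr.
pose L := Pseudoword LP.
have XL : X n @[n --> \oo] --> L.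
  move=> U /nbhs_pseudoword[S [f fU]]; exists #|S| => // n /= Sn.
  by apply: fU; rewrite /eval XS.
have -> : omega k = L by apply: cvg_lim => //; exact: pseudoword_hausdorff.
split=> // S f; transitivity (eval f (X #|S|)) => //.
exact: eval_spow.
Qed.

Definition satisfies (A : finType) (S : finSemigroupType) (u v : pseudoword A) :=
  forall f : A -> S, eval f u = eval f v.

Definition models (A : finType) (V : semigroupClass) (u v : pseudoword A) :=
  forall S, V S -> satisfies S u v.

(* [w = 1], that is [wz = z = zw] over the alphabet A extended by [z = None]. *)
Definition satisfies_one (A : finType) (S : finSemigroupType)
    (w : pseudoword A) :=
  let z : pseudoword (option A) := letter None in
  let w' : pseudoword (option A) := subst (fun a => letter (Some a)) w in
  satisfies S (w' * z) z /\ satisfies S z (z * w').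

Definition models_one (A : finType) (sigma : set (pseudoword A)) :
  semigroupClass := fun S => forall w, sigma w -> satisfies_one S w.

Definition abelian_groups : semigroupClass := fun S =>
  exists (e : S) (inv : S -> S),
    [/\ left_id e *%g, left_inverse e inv *%g & commutative (@mul S)].

Definition infinite_exponent (V : semigroupClass) :=
  forall n, (0 < n)%N -> ~ models V (omega n) (omega 0).

Section Factors.
Variable A : finType.

(* [None] stands for the empty pseudoword. *)
Definition mul1 (u v : option (pseudoword A)) : option (pseudoword A) :=
  match u, v with
  | Some u', Some v' => Some (u' * v')
  | None, _ => v
  | _, None => u
  end.

Definition suffix_of (v w : pseudoword A) :=
  exists w' : option (pseudoword A), Some w = mul1 w' (Some v).

Fixpoint subword_of (s : seq A) (w : option (pseudoword A)) : Prop :=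
  if s is a :: s' then
    exists w0 w', w = mul1 w0 (mul1 (Some (letter a)) w') /\ subword_of s' w'
  else True.

End Factors.

Definition signature := forall A : finType, set (pseudoword A).

Inductive tau_word (tau : signature) (A : finType) : set (pseudoword A) :=
  | tau_letter a : tau_word tau (letter a)
  | tau_op (B : finType) (w : pseudoword B) (u : B -> pseudoword A) :
      tau B w -> (forall b, tau_word tau (u b)) -> tau_word tau (subst u w).

Definition solution (V : semigroupClass) (A : finType) (S : finSemigroupType)
    (phi : pseudoword A -> S) (s t : S) (u v : pseudoword A) :=
  [/\ models V u v, phi u = s & phi v = t].

Definition reducible (tau : signature) (V : semigroupClass) :=
  forall (A : finType) (S : finSemigroupType)
    (phi : {multiplicative pseudoword A -> S}),
    continuous (phi : pseudoword A -> discrete_topology S) -> onto phi ->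
  forall s t : S,
    (exists u v, solution V phi s t u v) ->
    exists u v, [/\ solution V phi s t u v, tau_word tau u & tau_word tau v].

(* The two-letter alphabet {x, y}. *)
Definition x_ : bool := false.
Definition y_ : bool := true.

Inductive signature_omega (sigma : set (pseudoword bool)) : signature :=
  | signature_mul : signature_omega sigma (letter x_ * letter y_)
  | signature_sigma w : sigma w -> signature_omega sigma w
  | signature_power : signature_omega sigma (omega 0).

(* Main.v *)
Require Import Defs.
From HB Require Import structures.
From mathcomp Require Import all_boot monoid.
From mathcomp Require Import boolp classical_sets.

(** Let u be a word over {x, y} built from letters by multiplication, the
    operations of sigma and the omega-power. In every semigroup of H_sigma the
    last two kinds of operations take the value 1, so u has the same value there
    as a finite, possibly empty, word: the one that remains when the subterms
    headed by such operations are erased. In particular there is a natural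
    number m such that u(1, g) = g^m for all g in all members of H_sigma
    ([tau_word_exponent]). So it is enough to exhibit a V-solution with
    constraints that force u(1, g) = g^-1 in every abelian member of H_sigma:
    then g^(m+1) = 1 for all g in such groups, hence for all g in H_sigma, since
    every g generates a cyclic group that lies in H_sigma, and this contradicts
    infinite exponent.

    Such a solution is u = (xy)^(omega-1) x, v = y^(omega-1): both sides are
    equal to y^-1 in every group. The constraint on u is that it lies in the
    closure of (xy)*x, and the constraint on v that it lies in the closure of
    y+. Both are expressed by values in Brandt semigroups. An element of a
    Brandt semigroup over I is an arrow i -> j between points of I, or zero,
    and a nonzero product is a composite of arrows. If the letters act as
    arrows and are also given values in a group that are differences of a
    potential p : I -> G along these arrows, then every pseudoword whose arrow
    is i -> j has value p(i)^-1 p(j) ([eval_potential]). For u, with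
    x : 0 -> 1 and y : 1 -> 0, this yields u(g, g^-1) = g. For v, with a loop y
    and with x sent to zero, it yields v(g, 1) = 1 whatever the value g of x;
    as V satisfies u = v, also u(g, 1) = 1. In an abelian group evaluation is
    multiplicative in the assignment ([eval_commutative]), so that
    1 = u(g, 1) = u(g, g^-1) u(1, g) = g u(1, g). *)

Set Implicit Arguments.
Unset Strict Implicit.
Unset Printing Implicit Defensive.

Import Algebra.

Local Open Scope classical_set_scope.
Local Open Scope group_scope.

(** * Powers and identities in semigroups *)

Lemma spowM (S : semigroupType) (s : S) m n :
  (0 < m)%N -> (0 < n)%N -> spow (spow s m) n = spow s (m * n).
Proof.
move=> m_gt0; elim: n => [//|[|n] IHn] _; first by rewrite muln1.
by rewrite spowS // IHn // -spowD ?muln_gt0 ?m_gt0 // (mulnS m n.+1).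
Qed.

Lemma spow_idempotent (S : semigroupType) (s : S) n : s * s = s -> spow s n = s.
Proof. by move=> ss; elim: n => [//|[//|n] IHn]; rewrite spowS // IHn. Qed.

Lemma left_right_id_eq (S : semigroupType) (e e' : S) :
  left_id e *%g -> right_id e' *%g -> e = e'.
Proof. by move=> idl idr; rewrite -[LHS]idr idl. Qed.

(** * Evaluation of pseudowords *)

Lemma eval_const_spow (S : finSemigroupType) (s : S) (A : finType)
    (w : pseudoword A) :
  exists2 k, (0 < k)%N & eval (fun=> s) w = spow s k.
Proof.
have [u uW <-] := eval_finite_word (fun=> s) w.
elim: uW => [a|{w}u v _ [k k0 uk] _ [l l0 vl]].
  by exists 1%N; rewrite // eval_letter.
by exists (k + l)%N; rewrite ?addn_gt0 ?k0 // evalM uk vl spowD.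
Qed.

(** Evaluating in the product of three copies of S gives one finite word that
    takes the values of [u] under all three assignments, which reduces the claim
    to an induction on finite words. *)
Lemma eval_commutative (A : finType) (S : finSemigroupType) (f g : A -> S)
    (u : pseudoword A) :
  commutative (@mul S) ->
  eval (fun a => f a * g a) u = eval f u * eval g u.
Proof.
move=> mulC.
have [u' u'W] := eval_finite_word (fun a => ((f a, g a), f a * g a)) u.
move=> uu'; have := congr1 snd uu'; have := congr1 fst uu'.
rewrite !(eval_natural fst) !(eval_natural snd) => /= uu1.
have := congr1 snd uu1; have := congr1 fst uu1.
rewrite !(eval_natural fst) !(eval_natural snd) => /= <- <- <- {u uu' uu1}.
change (eval (fun a => f a * g a) u' = eval f u' * eval g u').
elim: u'W => [a|u v _ IHu _ IHv]; first by rewrite !eval_letter.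
rewrite !evalM IHu IHv !mulgA.
by rewrite -(mulgA (eval f u) (eval g u)) (mulC (eval g u)) !mulgA.
Qed.

Lemma spow_fact_pred (S : finSemigroupType) (s : S) n :
  (#|S| <= n)%N -> spow s (n`! + n`!.-1) = spow s ((#|S|)`! + (#|S|)`!.-1).
Proof.
move=> Sn; rewrite spow_fact //.
have -> : ((#|S|)`! + n`!.-1 = n`! + (#|S|)`!.-1)%N.
  case: (n`!) (fact_gt0 n) ((#|S|)`!) (fact_gt0 #|S|) => // k _ [] //= l _.
  by rewrite addSnnS addnC.
exact: spow_fact.
Qed.

(** The operation x^(omega-1). The exponent n! + (n! - 1) is used instead of
    n! - 1 because it is positive and because powers of this form already have
    their limit value from n = #|S| on. *)
Lemma omega_pred_exists : exists w : pseudoword unit,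
  forall (S : finSemigroupType) (s : S),
    eval (fun=> s) w = spow s ((#|S|)`! + (#|S|)`!.-1).
Proof.
pose X n : pseudoword unit := spow (letter tt) (n`! + n`!.-1).
have XS (S : table) (f : unit -> 'I_(Defs.tsize S)) n :
    (Defs.tsize S <= n)%N -> X n S f = X (Defs.tsize S) S f.
  move=> Sn; have S_gt0 := tsize_gt0 (letter tt) f.
  have E m : X m S f = spow (f tt : carrier S_gt0) (m`! + m`!.-1).
    by rewrite -(@eval_carrier S S_gt0) eval_spow.
  rewrite !E; have := @spow_fact_pred (carrier S_gt0) (f tt) n.
  by rewrite (card_ord (Defs.tsize S) : #|{: carrier S_gt0}| = _); apply.
have LP (S T : table) (h : 'I_(Defs.tsize S) -> 'I_(Defs.tsize T)) :
    {morph h : i j / tmul i j} -> forall f : unit -> 'I_(Defs.tsize S),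
    h (X (Defs.tsize S) S f) = X (Defs.tsize T) T (h \o f).
  move=> hM f; rewrite -(XS S f (maxn (Defs.tsize S) (Defs.tsize T))) ?leq_maxl //.
  by rewrite (pwopP _ hM) XS // leq_maxr.
exists (Pseudoword LP) => S s; transitivity (eval (fun=> s) (X #|S|)) => //.
exact: eval_spow.
Qed.

(** * The subsemigroup generated by an assignment *)

Section EvalRange.
Variables (A : finType) (S : finSemigroupType) (f : A -> S).

(** The subsemigroup of S generated by the values of [f]. The letter in the
    argument witnesses that it is nonempty. *)
Definition eval_range of A : Type := {s : S | `[< range (eval f) s >]}.

Variable a0 : A.

HB.instance Definition _ :=
  Finite.copy (eval_range a0) {s : S | `[< range (eval f) s >]}.

Lemma eval_in_range (u : pseudoword A) : `[< range (eval f) (eval f u) >].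
Proof. by apply/asboolP; exists u. Qed.

Lemma eval_range_closed (s t : eval_range a0) :
  `[< range (eval f) (val s * val t) >].
Proof.
case: s t => [s /= /asboolP[u _ <-]] [t /= /asboolP[v _ <-]].
by rewrite -evalM; exact: eval_in_range.
Qed.

Definition eval_range_mul (s t : eval_range a0) : eval_range a0 :=
  exist _ (val s * val t) (eval_range_closed s t).

Lemma eval_range_mulA : associative eval_range_mul.
Proof. by move=> r s t; apply: val_inj; exact: mulgA. Qed.

HB.instance Definition _ := isSemigroup.Build (eval_range a0) eval_range_mulA.

Definition range_gen (a : A) : eval_range a0 :=
  exist _ (eval f (letter a)) (eval_in_range (letter a)).

HB.instance Definition _ :=
  isNonempty.Build (eval_range a0) (inhabits (range_gen a0)).

Definition range_val (s : eval_range a0) : S := val s.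

Lemma range_valM : {morph range_val : s t / s * t}.
Proof. by []. Qed.

HB.instance Definition _ :=
  isMultiplicative.Build (eval_range a0) S range_val range_valM.

Lemma range_valE (u : pseudoword A) : range_val (eval range_gen u) = eval f u.
Proof.
rewrite eval_natural; congr eval; apply: funext => a /=.
exact: eval_letter.
Qed.

Lemma range_gen_onto : onto (eval range_gen).
Proof.
move=> [s /[dup] /asboolP[u _ us] sR]; exists u; apply: val_inj.
by rewrite -[LHS]/(range_val _) range_valE.
Qed.

End EvalRange.

(** Reducibility may be applied to an evaluation that is not onto, by
    restricting its codomain to its range. So the constraints can be imposed in
    any convenient semigroup, such as a product, without finding out which part
    of it is generated by the letters. *)
Lemma reducible_not_onto (tau : signature) (V : semigroupClass) (A : finType)
    (S : finSemigroupType) (f : A -> S) (u v : pseudoword A) :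
  inhabited A -> reducible tau V -> models V u v ->
  exists u' v', [/\ models V u' v', eval f u' = eval f u,
    eval f v' = eval f v, tau_word tau u' & tau_word tau v'].
Proof.
move=> [a0] tauV uv; have := tauV A _ (eval (range_gen f a0)).
move=> /(_ (@eval_continuous _ _ _) (@range_gen_onto _ _ f a0)).
case/(_ (eval (range_gen f a0) u) (eval (range_gen f a0) v)).
  by exists u, v.
move=> u' [v' [[uv' uu' vv'] tu' tv']]; exists u', v'; split=> //.
  by rewrite -!(range_valE f a0) uu'.
by rewrite -!(range_valE f a0) vv'.
Qed.

(** * Brandt semigroups *)

Section Brandt.
Variable I : finType.

(** The aperiodic Brandt semigroup over I: [Some (i, j)] is the arrow i -> j
    (the matrix unit e_ij) and [None] is zero. *)
Definition brandt : Type := option (I * I).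

Definition brandt_mul (p q : brandt) : brandt :=
  match p, q with
  | Some (i, j), Some (k, l) => if j == k then Some (i, l) else None
  | _, _ => None
  end.

Lemma brandt_mulA : associative brandt_mul.
Proof.
case=> [[i j]|] [[k l]|] [[m n]|] //=; last by case: ifP.
by case Elm: (l == m); case Ejk: (j == k); rewrite /= ?Elm ?Ejk.
Qed.

HB.instance Definition _ := Finite.copy brandt (option (I * I)).
HB.instance Definition _ := isSemigroup.Build brandt brandt_mulA.
HB.instance Definition _ := isNonempty.Build brandt (inhabits None).

Lemma brandt_mul_Some (p q : brandt) i j :
  p * q = Some (i, j) -> exists k, p = Some (i, k) /\ q = Some (k, j).
Proof.
case: p q => [[i' k]|] [[k' j']|] //; rewrite /mul /=.
by case Ek: (k == k') => // -[<- <-]; exists k; rewrite (eqP Ek).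
Qed.

(** The pairs (arrow i -> j, s) with p(i) s = p(j), together with all pairs
    whose first component is zero, form a subsemigroup of the product. *)
Lemma eval_potential (A : finType) (f : A -> brandt) (S : finSemigroupType)
    (c : A -> S) (p : I -> S) (u : pseudoword A) i j :
  (forall a k l, f a = Some (k, l) -> p k * c a = p l) ->
  eval f u = Some (i, j) -> p i * eval c u = p j.
Proof.
move=> pc; have [u' u'W] := eval_finite_word (fun a => (f a, c a)) u.
move=> uu'; have := congr1 snd uu'; have := congr1 fst uu'.
rewrite !(eval_natural fst) !(eval_natural snd) => /= <- <- {u uu'}.
elim: u'W i j => [a|u v _ IHu _ IHv] i j.
  by rewrite !eval_letter; exact: pc.
rewrite !evalM => /brandt_mul_Some[k [fu fv]].
by rewrite mulgA (IHu _ _ fu) (IHv _ _ fv).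
Qed.

End Brandt.

(** * Models of w = 1 for w in sigma *)

Section ModelsOne.
Variables (sigma : set (pseudoword bool)) (S : finSemigroupType).
Hypothesis sigmaS : models_one sigma S.

Lemma models_one_eval w (f : bool -> S) :
  sigma w -> left_id (eval f w) *%g /\ right_id (eval f w) *%g.
Proof.
move=> /sigmaS[wz zw]; apply/all_and2 => z.
pose g o := if o is Some a then f a else z.
have := zw g; have := wz g; rewrite !evalM eval_subst eval_letter.
have -> : (fun a => eval g (letter (Some a))) = f.
  by apply: funext => a; rewrite eval_letter.
by move=> -> <-.
Qed.

Hypothesis sigma_nonempty : sigma !=set0.

(** For w in sigma the element w(s, s) is an identity and also a positive power
    s^k of s, and k divides n! as soon as n >= k. *)
Lemma models_one_omega (s : S) :
  left_id (spow s (#|S|)`!) *%g /\ right_id (spow s (#|S|)`!) *%g.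
Proof.
have [w sw] := sigma_nonempty; have [k k0 wk] := eval_const_spow s w.
have [idl idr] := models_one_eval (fun=> s) sw.
suff -> : spow s (#|S|)`! = eval (fun=> s) w by [].
have := @spow_fact S s 0 (maxn #|S| k) (leq_maxl _ _); rewrite !addn0 => <-.
have /dvdnP[q Eq] : k %| (maxn #|S| k)`! by rewrite dvdn_fact // k0 leq_maxr.
have q0 : (0 < q)%N.
  by have := fact_gt0 (maxn #|S| k); rewrite Eq muln_gt0 => /andP[].
by rewrite Eq mulnC -spowM // -wk spow_idempotent // idl.
Qed.

Lemma models_one_group : exists e : S,
  [/\ left_id e *%g, right_id e *%g, forall s, spow s (#|S|)`! = e
    & forall s (s' := spow s ((#|S|)`! + (#|S|)`!.-1)),
        s * s' = e /\ s' * s = e].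
Proof.
have [s0] := Defs.nonempty (s := S); pose e := spow s0 (#|S|)`!.
have [idl idr] := models_one_omega s0.
have pE s : spow s (#|S|)`! = e.
  by have [idl' _] := models_one_omega s; exact: left_right_id_eq.
have F0 := fact_gt0 #|S|.
have p2E s : spow s ((#|S|)`! + (#|S|)`!) = e by rewrite spowD // pE idl.
exists e; split=> // s /=; split.
  by rewrite -spowS ?addn_gt0 ?F0 // -addnS prednK.
rewrite -[X in _ * X]/(spow s 1) -spowD ?addn_gt0 ?F0 //.
by rewrite -addnA addn1 prednK.
Qed.

End ModelsOne.

Lemma models_one_sub (sigma : set (pseudoword bool)) (S T : finSemigroupType)
    (h : {multiplicative T -> S}) :
  injective h -> models_one sigma S -> models_one sigma T.
Proof.
move=> h_inj sS w /sS[wz zw]; split=> f; apply: h_inj; rewrite !eval_natural.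
  exact: wz.
exact: zw.
Qed.

(** The number of occurrences of [b] that remain when the subterms headed by the
    omega-power or by an operation of sigma are erased: it is the same in all
    models, and it is never negative because no such operation inverts. *)
Lemma tau_word_exponent (sigma : set (pseudoword bool)) (A : finType) (b : A)
    (u : pseudoword A) :
  sigma !=set0 -> tau_word (signature_omega sigma) u ->
  exists m : nat, forall (S : finSemigroupType) (e s : S),
    models_one sigma S -> left_id e *%g -> right_id e *%g ->
    eval (fun a => if a == b then s else e) u = iter m (mul s) e.
Proof.
move=> s0; elim=> [a|B w {}u tw _ IH].
  exists (a == b : nat) => S e s _ idl idr; rewrite eval_letter.
  by case: eqP => //=; rewrite idr.
case: {B w} tw u IH => [u IH|w sw u _|u _].
- have [[m um] [n un]] := (IH x_, IH y_).
  exists (m + n)%N => S e s sS idl idr.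
  rewrite eval_subst evalM !eval_letter um // un // iterD.
  by elim: m {um} => [|m IHm] /=; rewrite ?idl // -mulgA IHm.
- exists 0%N => S e s sS idl idr; rewrite eval_subst /=.
  apply: left_right_id_eq => //.
  by have [] := models_one_eval sS
    (fun c => eval (fun a => if a == b then s else e) (u c)) sw.
- exists 0%N => S e s sS idl idr; rewrite eval_subst /= (omegaP 0).2 addn0.
  apply: left_right_id_eq => //.
  by have [] := models_one_omega sS s0
    (eval (fun a => if a == b then s else e) (u tt)).
Qed.

(** Infinite exponent is witnessed by cyclic groups: if s^n is not the identity
    in some model, the subsemigroup generated by s is an abelian model. *)
Lemma infinite_exponent_abelian (sigma : set (pseudoword bool)) n :
  sigma !=set0 -> infinite_exponent (models_one sigma) -> (0 < n)%N ->
  exists (C : finSemigroupType) (g e h : C),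
    [/\ models_one sigma C, abelian_groups C, commutative (@mul C)
     & [/\ left_id e *%g, right_id e *%g, g * h = e & spow g n <> e]].
Proof.
move=> s0 inf n_gt0.
have [S [s [sS sn]]] : exists (S : finSemigroupType) (s : S),
    models_one sigma S /\ spow s ((#|S|)`! + n) <> spow s (#|S|)`!.
  apply: contrapT => H; apply: (inf n n_gt0) => S sS f.
  rewrite !(omegaP _).2 addn0; apply: contrapT => neq; apply: H.
  by exists S, (f tt).
pose C : finSemigroupType := eval_range (fun _ : unit => s) tt.
pose g : C := range_gen (fun=> s) tt tt.
have sC : models_one sigma C.
  by apply: (@models_one_sub _ _ C (@range_val _ _ _ _)) sS; exact: val_inj.
have gP (t : C) : exists2 k, (0 < k)%N & t = spow g k.
  have [u <-] := range_gen_onto t.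
  have -> : range_gen (fun=> s) tt = fun=> g by apply: funext => -[].
  by have [k k0 ->] := eval_const_spow g u; exists k.
have mulC : commutative (@mul C).
  move=> t t'; have [[k k0 ->] [l l0 ->]] := (gP t, gP t').
  by rewrite -!spowD // addnC.
have [e [idl idr _ invC]] := models_one_group sC s0.
exists C, g, e, (spow g ((#|C|)`! + (#|C|)`!.-1)); split=> //.
  exists e, (fun t => spow t ((#|C|)`! + (#|C|)`!.-1)); split=> // t.
  by have [] := invC t.
split=> //; first by have [] := invC g.
move=> gn; apply: sn; have [e' [_ idr' pE' invS]] := models_one_group sS s0.
have vg : range_val g = s by rewrite /range_val /= eval_letter.
(* The identity of the subsemigroup is the identity of S: it fixes s, which is
   invertible in S. *)
have ve : range_val e = e'.
  have es : range_val e * s = s.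
    by have := congr1 (@range_val _ _ _ _) (idl g); rewrite range_valM vg.
  by have [ss' _] := invS s; rewrite -[LHS]idr' -ss' mulgA es.
have vgn : range_val (spow g n) = spow s n.
  by transitivity (spow (range_val g) n); [exact: gmulf_spow | congr spow].
by rewrite spowD ?fact_gt0 // pE' -vgn gn ve idr'.
Qed.

(** * Irreducibility *)

Theorem theorem5 (sigma : set (pseudoword bool)) (V : semigroupClass)
  (sigma_nonempty : sigma !=set0)
  (sigma_cases : forall w, sigma w ->
    (suffix_of (spow (letter x_) 3) w \/ suffix_of (spow (letter y_) 3) w) \/
    (subword_of [:: x_; y_; x_] (Some w) /\ subword_of [:: y_; x_; y_] (Some w)))
  (sigma_exponent : infinite_exponent (models_one sigma))
  (V_pseudovariety : pseudovariety V)
  (V_lower : forall S, models_one sigma S -> abelian_groups S -> V S)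
  (V_upper : forall S, V S -> models_one sigma S) :
  ~ reducible (signature_omega sigma) V.
Proof.
move=> red; have [w wE] := omega_pred_exists.
pose x : pseudoword bool := letter x_; pose y : pseudoword bool := letter y_.
pose u := subst (fun=> x * y) w * x; pose v := subst (fun=> y) w.
have uv : models V u v.
  move=> S /V_upper sS f; rewrite /u /v evalM !eval_subst !wE !evalM.
  have [e [idl idr _ inv]] := models_one_group sS sigma_nonempty.
  have [_ xyV] := inv (eval f x * eval f y).
  have [yV _] := inv (eval f y).
  by rewrite -[LHS]idr -yV mulgA -(mulgA _ (eval f x)) xyV idl.
(* The first component recognizes (xy)*x by the arrow 0 -> 1, the second one y+
   by the loop; together they are the constraints on u and v. *)
pose F (c : bool) : (brandt bool * brandt unit)%type :=
  if c then (Some (true, false), Some (tt, tt)) else (Some (false, true), None).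
have [u' [v' [uv' u'F v'F tu' _]]] :=
  reducible_not_onto F (inhabits x_) red uv.
have [m mE] := tau_word_exponent y_ sigma_nonempty tu'.
have [C [g [e [h [sC abC mulC [idl idr gh gm]]]]]] :=
  infinite_exponent_abelian sigma_nonempty sigma_exponent (ltn0Sn m).
have u'gh : eval (fun c => if c then h else g) u' = g.
  rewrite -[LHS]idl.
  apply: (eval_potential (f := fst \o F) (p := fun i => if i then g else e)
    (i := false) (j := true)).
    by case=> k l [<- <-]; rewrite ?idl.
  rewrite -(eval_natural fst) u'F (eval_natural fst) /u evalM eval_subst wE.
  rewrite evalM !eval_letter.
  by rewrite spow_idempotent.
have u'ge : eval (fun c => if c then e else g) u' = e.
  transitivity (eval (fun c => if c then e else g) v').
    by apply: uv'; exact: V_lower.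
  rewrite -[LHS]idl.
  apply: (eval_potential (f := snd \o F) (p := fun=> e) (i := tt) (j := tt)).
    by case=> [] [] [] //= _; exact: idl.
  rewrite -(eval_natural snd) v'F (eval_natural snd) /v eval_subst wE.
  by rewrite eval_letter spow_idempotent.
(* The assignment (g, 1) is the product of (g, g^-1) and (1, g). *)
apply: gm; have := u'ge.
have -> : (fun c : bool => if c then e else g) =
    fun c => (if c then h else g) * (if c == y_ then g else e).
  by apply: funext => -[] /=; rewrite ?idr // mulC.
rewrite eval_commutative // u'gh mE // => <-.
elim: m {mE} => [|m IHm]; first by rewrite /= idr.
by rewrite spowS // IHm.
Qed.
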